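(* Let $n\ge 1$ be an integer and let $0<s<n$. Fix $1\le p,q\le\infty$ and $0<r<\infty$. If there exists a constant $C>0$ such that $$\|\mathcal J_s(f,g)\|_{L^{r,\infty}(\mathbb R^n)}\le C\,\|f\|_{L^p(\mathbb R^n)}\,\|g\|_{L^q(\mathbb R^n)}\qquad\text{for all } f,g\in\mathcal S(\mathbb R^n),$$ then necessarily $$\frac1p+\frac1q-\frac sn\ \le\ \frac1r\ \le\ \frac1p+\frac1q .$$
   Context: $\mathcal S(\mathbb R^n)$ is the Schwartz space. For $0<s<n$, $G_s$ denotes the Bessel kernel of order $s$ on $\mathbb R^n$: the nonnegative integrable function whose Fourier transform (with convention $\widehat{h}(\xi)=\int h(x)e^{-2\pi i x\cdot\xi}\,dx$) is $\widehat{G_s}(\xi)=(1+4\pi^2|\xi|^2)^{-s/2}$. The bilinear Bessel potential is $$\mathcal J_s(f,g)(x)=\int_{\mathbb R^n}G_s(y)\,f(x-y)\,g(x+y)\,dy .$$ For a measurable $h$ on $\mathbb R^n$ let $d_h(\lambda)=|\{|h|>\lambda\}|$ and $h^*(t)=\inf\{\lambda>0: d_h(\lambda)\le t\}$. For $0<r<\infty$, $\|h\|_{L^{r,\infty}}=\sup_{t>0}t^{1/r}h^*(t)=\sup_{\lambda>0}\lambda\, d_h(\lambda)^{1/r}$. Convention: $1/\infty=0$. *)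

(* Defs.v *)
From HB Require Import structures.
From mathcomp Require Import all_boot all_order all_algebra.
From mathcomp Require Import all_classical all_reals all_analysis.
From mathcomp Require Import measurable_realfun complex.

Set Implicit Arguments.
Unset Strict Implicit.
Unset Printing Implicit Defensive.

Import Order.TTheory GRing.Theory Num.Theory.
Import numFieldNormedType.Exports.

Local Open Scope classical_set_scope.
Local Open Scope ring_scope.
Local Open Scope complex_scope.

(* The sigma-algebra on R^n generated by the n coordinate maps; it is the Borel
   sigma-algebra, see [rV_measurableE] below. *)
Definition rV_display : measure_display -> measure_display.
Proof. exact. Qed.

Section rV_measurable.
Context {R : realType} {n : nat}.

Let coors : 'I_n -> 'rV[R]_n -> R := fun i x => x ord0 i.

Let rV_set0 : g_sigma_preimage coors set0.
Proof. exact: sigma_algebra0. Qed.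

Let rV_setC A : g_sigma_preimage coors A -> g_sigma_preimage coors (~` A).
Proof. exact: sigma_algebraC. Qed.

Let rV_bigcup (F : (set 'rV[R]_n)^nat) :
  (forall i, g_sigma_preimage coors (F i)) ->
  g_sigma_preimage coors (\bigcup_i (F i)).
Proof. exact: sigma_algebra_bigcup. Qed.

HB.instance Definition _ := @isMeasurable.Build (rV_display default_measure_display)
  'rV[R]_n (g_sigma_preimage coors) rV_set0 rV_setC rV_bigcup.

End rV_measurable.

Section rV_measurable_fun.
Context {R : realType} {d} {T : measurableType d}.

Lemma measurable_coord n (i : 'I_n) :
  measurable_fun setT (fun x : 'rV[R]_n => x ord0 i).
Proof.
move=> _ Y mY; rewrite setTI; apply: sub_sigma_algebra => /=.
rewrite -bigcup_seq; exists i => /=; first by rewrite mem_index_enum.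
by exists Y => //; rewrite setTI.
Qed.

Lemma measurable_fun_rVP n (f : T -> 'rV[R]_n) :
  measurable_fun setT f <->
  forall i, measurable_fun setT (fun x => f x ord0 i).
Proof.
split=> [mf i|mf]; first exact: measurableT_comp (measurable_coord i) mf.
pose c (i : 'I_n) (x : 'rV[R]_n) := x ord0 i.
have mE : @measurable _ 'rV[R]_n =
  <<s \big[setU/set0]_(i < n) preimage_set_system setT (c i) measurable >> by [].
refine (@measurability _ _ T _ setT f _ mE _) => _ [B + <-].
rewrite -bigcup_seq => -[i _ [A mA <-]].
by rewrite setTI -comp_preimage; exact: mf.
Qed.

End rV_measurable_fun.

Lemma measurable_rV_box {R : realType} n (A : 'I_n -> set R) :
  (forall i, measurable (A i)) ->
  measurable [set x : 'rV[R]_n | forall i, A i (x ord0 i)].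
Proof.
move=> mA.
rewrite [X in measurable X](_ : _ =
    \bigcap_(i in setT) ((fun x : 'rV[R]_n => x ord0 i) @^-1` A i)); last first.
  by apply/seteqP; split => x /= h i; [move=> _; exact: h|exact: h].
apply: fin_bigcap_measurable; first exact: finite_finset.
by move=> i _; rewrite -[X in measurable X]setTI; exact: measurable_coord.
Qed.

Lemma open_measurable_rV {R : realType} n (U : set 'rV[R]_n) :
  open U -> measurable U.
Proof.
move=> oU.
pose c (p : 'rV[rat]_n * nat) : 'rV[R]_n := map_mx ratr p.1.
pose r (p : 'rV[rat]_n * nat) : R := p.2.+1%:R^-1.
pose F p := if `[< ball (c p) (r p) `<=` U >] then ball (c p) (r p) else set0.
rewrite (_ : U = \bigcup_p F p).
  apply: countable_bigcupT_measurable => [|p].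
    exact: (@countableP ('rV[rat]_n * nat)%type).
  rewrite /F; case: ifP => // _.
  rewrite [X in measurable X](_ : _ = [set x : 'rV[R]_n |
      forall i, ball (c p ord0 i) (r p) (x ord0 i)]).
    apply: (@measurable_rV_box _ _ (fun i => ball (c p ord0 i) (r p))) => i.
    by apply: open_measurable; apply: ball_open; rewrite invr_gt0 ltr0n.
  apply/seteqP; split => [x [_ h] i|x h]; first exact: h.
  by split; [rewrite invr_gt0 ltr0n|move=> i j; rewrite (ord1 i)].
apply/seteqP; split => [x Ux|x [p _]]; last first.
  by rewrite /F; case: asboolP => // h /h.
have /nbhs_ballP[e /= e0 xeU] : nbhs x U by apply: open_nbhs_nbhs.
have [k ke] : exists k, (k.+1%:R^-1 : R) < e / 2.
  have e20 : 0 < e / 2 by rewrite divr_gt0.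
  near \oo => k; exists k; near: k; exact: near_infty_natSinv_lt (PosNum e20).
have hq (i : 'I_n) : {q : rat | `|x ord0 i - ratr q| < k.+1%:R^-1}.
  have k0 : (0 : R) < k.+1%:R^-1 by rewrite invr_gt0 ltr0n.
  have : x ord0 i < x ord0 i + k.+1%:R^-1 by rewrite ltrDl.
  move=> /rat_in_itvoo/cid[q]; rewrite in_itv/= => /andP[q1 q2].
  exists q; rewrite distrC ger0_norm ?subr_ge0 ?ltW//.
  by rewrite ltrBlDl.
pose p := (\row_i sval (hq i), k) : 'rV[rat]_n * nat.
have xp : ball (c p) k.+1%:R^-1 x.
  split; first by rewrite invr_gt0 ltr0n.
  move=> i j; rewrite (ord1 i) /c /p !mxE /ball/= distrC.
  exact: (svalP (hq j)).
exists p => //; rewrite /F; case: asboolP => //= h; exfalso; apply: h => y py.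
apply: xeU; apply: (@ball_splitr _ _ (c p)); apply: le_ball (ltW ke) _ _ => //.
Unshelve. all: by end_near. Qed.

Lemma rV_measurableE {R : realType} n :
  @measurable _ 'rV[R]_n = <<s [set U | open U] >>.
Proof.
apply/seteqP; split; last first.
  apply: smallest_sub; first exact: sigma_algebra_measurable.
  exact: open_measurable_rV.
apply: smallest_sub; first exact: smallest_sigma_algebra.
move=> B; rewrite -bigcup_seq => -[i _ [A mA <-]]; rewrite setTI.
pose D := <<s [set U : set 'rV[R]_n | open U] >>.
pose f (x : g_sigma_algebraType [set U : set 'rV[R]_n | open U]) : R :=
  (x : 'rV[R]_n) ord0 i.
suff mf : measurable_fun setT f by have := mf measurableT A mA; rewrite setTI.
apply: (measurability _ (RGenOpens.measurableE R)).
move=> _ [_ [a [b ->] <-]]; rewrite setTI; apply: sub_sigma_algebra.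
apply: open_comp; last exact: interval_open.
by move=> x _; exact: coord_continuous.
Qed.

(* Lebesgue measure on R^n, by induction on n: the image of the product of the
   one-dimensional Lebesgue measure and the Lebesgue measure on R^n under the
   identification of R * R^n with R^(n+1). *)
Section lebesgueN.
Context {R : realType}.

Definition rV_cons n (p : R * 'rV[R]_n) : 'rV[R]_n.+1 :=
  \row_i oapp (p.2 ord0) p.1 (unlift ord0 i).

Definition rV_uncons n (x : 'rV[R]_n.+1) : R * 'rV[R]_n :=
  (x ord0 ord0, \row_j x ord0 (lift ord0 j)).

Lemma rV_consK n : cancel (@rV_cons n) (@rV_uncons n).
Proof.
case=> t y; rewrite /rV_uncons /rV_cons !mxE unlift_none/=; congr pair.
by apply/rowP => j; rewrite !mxE liftK.
Qed.

Lemma measurable_rV_cons n :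
  measurable_fun [set: measurableTypeR R * 'rV[R]_n] (@rV_cons n).
Proof.
apply/measurable_fun_rVP => i; rewrite /rV_cons.
under eq_fun do rewrite mxE.
case: (unlift ord0 i) => [j|] /=; last exact: measurable_fst.
exact: measurableT_comp (measurable_coord j) measurable_snd.
Qed.

Lemma measurable_rV_uncons n : measurable_fun setT
  (@rV_uncons n : 'rV[R]_n.+1 -> measurableTypeR R * 'rV[R]_n).
Proof.
apply: measurable_fun_pair; first exact: measurable_coord.
apply/measurable_fun_rVP => i; under eq_fun do rewrite mxE.
exact: measurable_coord.
Qed.

Section step.
Variables (n : nat) (mu : {sigma_finite_measure set 'rV[R]_n -> \bar R}).

Definition lebesgueS : set 'rV[R]_n.+1 -> \bar R :=
  pushforward (@lebesgue_measure R \x mu)%E (@rV_cons n).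

HB.instance Definition _ := Measure.copy lebesgueS
  (measure_function_pushforward__canonical__measure_function_Measure
    (@lebesgue_measure R \x mu)%E (@measurable_rV_cons n)).

Let lebesgueS_sigma_finite : sigma_finite setT lebesgueS.
Proof.
have /sigma_finiteP[F [TF ndF Foo]] := sigma_finiteT (@lebesgue_measure R).
have /sigma_finiteP[H [TH ndH Hoo]] := sigma_finiteT mu.
exists (fun k => @rV_uncons n @^-1` (F k `*` H k)).
  rewrite -preimage_bigcup (_ : \bigcup_k _ = setT) ?preimage_setT//.
  apply/seteqP; split => // -[t y] _.
  have [i _ Ft] : (\bigcup_i F i) t by rewrite -TF.
  have [j _ Hy] : (\bigcup_j H j) y by rewrite -TH.
  exists (maxn i j) => //; split => /=.
    by move: t Ft; exact/subsetPset/ndF/leq_maxl.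
  by move: y Hy; exact/subsetPset/ndH/leq_maxr.
move=> k; have [mF Fk] := Foo k; have [mH Hk] := Hoo k.
have mFH : measurable (F k `*` H k) by exact: measurableX.
split.
  by rewrite -[X in measurable X]setTI; exact: measurable_rV_uncons.
rewrite /lebesgueS /pushforward -comp_preimage.
rewrite (_ : @rV_uncons n \o @rV_cons n = id); last exact/funext/rV_consK.
by rewrite preimage_id product_measure1E// lte_mul_pinfty// ge0_fin_numE.
Qed.

HB.instance Definition _ := Measure_isSigmaFinite.Build _ _ _ lebesgueS
  lebesgueS_sigma_finite.

End step.

Fixpoint lebesgueN (n : nat) : {sigma_finite_measure set 'rV[R]_n -> \bar R} :=
  match n with
  | 0 => \d_(0 : 'rV[R]_0)
  | n'.+1 => lebesgueS (lebesgueN n')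
  end.

Lemma lebesgueN_box n (A : 'I_n -> set R) : (forall i, measurable (A i)) ->
  lebesgueN n [set x | forall i, A i (x ord0 i)] =
  (\prod_(i < n) lebesgue_measure (A i))%E.
Proof.
elim: n A => [|n IHn] A mA.
  by rewrite big_ord0 /= diracE mem_set// => -[].
rewrite big_ord_recl -IHn//= /lebesgueS /pushforward.
rewrite -product_measure1E; [|exact: mA|]; last first.
  by apply: (@measurable_rV_box _ _ (fun i => A (lift ord0 i))).
congr (_ _); apply/seteqP; split => [[t y]/= h|[t y]/= [h0 h] i].
  split; first by have := h ord0; rewrite mxE unlift_none.
  by move=> i; have := h (lift ord0 i); rewrite mxE liftK.
by rewrite mxE; case: unliftP => [j ->|->] /=; [exact: h|].
Qed.

End lebesgueN.

Section euclidean.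
Context {R : realType} {n : nat}.
Implicit Types x y : 'rV[R]_n.

Definition dotrV x y : R := \sum_(i < n) x ord0 i * y ord0 i.

(* The norm [`|x|] of the library is the sup norm. *)
Definition enorm x : R := Num.sqrt (dotrV x x).

End euclidean.

Section schwartz.
Context {R : realType} {n : nat}.

Definition partials (l : seq 'I_n) (f : 'rV[R]_n -> R) : 'rV[R]_n -> R :=
  foldr (fun i h => 'D_(delta_mx ord0 i) h) f l.

Definition smooth (f : 'rV[R]_n -> R) : Prop :=
  forall l : seq 'I_n, continuous (partials l f) /\
    forall (i : 'I_n) x, derivable (partials l f) x (delta_mx ord0 i).

Definition rapidly_decreasing (f : 'rV[R]_n -> R) : Prop :=
  forall (a : 'I_n -> nat) (l : seq 'I_n), exists M : R, forall x : 'rV[R]_n,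
    `|(\prod_(i < n) x ord0 i ^+ a i) * partials l f x| <= M.

Definition schwartzR (f : 'rV[R]_n -> R) : Prop :=
  smooth f /\ rapidly_decreasing f.

(* R[i] is not a normed module over R in the library, so complex-valued functions
   are differentiated (and integrated, see [integralC]) componentwise. *)
Definition schwartz (f : 'rV[R]_n -> R[i]) : Prop :=
  schwartzR (fun x => complex.Re (f x)) /\ schwartzR (fun x => complex.Im (f x)).

End schwartz.

Definition integralC {d} {T : measurableType d} {R : realType}
    (mu : {measure set T -> \bar R}) (f : T -> R[i]) : R[i] :=
  (\int[mu]_x complex.Re (f x)) +i* (\int[mu]_x complex.Im (f x)).

Section bessel.
Context {R : realType} {n : nat}.

Definition cis (t : R) : R[i] := cos t +i* sin t.

Definition fourier (h : 'rV[R]_n -> R[i]) (xi : 'rV[R]_n) : R[i] :=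
  integralC (lebesgueN n) (fun x => h x * cis (- (2 * pi * dotrV x xi))).

(* The Fourier transform determines G up to a null set. *)
Definition is_bessel_kernel (s : R) (G : 'rV[R]_n -> R) : Prop :=
  [/\ forall x, 0 <= G x,
      (lebesgueN n).-integrable setT (EFin \o G) &
      forall xi, fourier (fun x => (G x)%:C) xi =
        ((1 + 4 * pi ^+ 2 * enorm xi ^+ 2) `^ (- (s / 2)))%:C].

(* [bilinear_potential G] is the bilinear Bessel potential of order s when
   [is_bessel_kernel s G]; it depends only on the almost everywhere class
   of G. *)
Definition bilinear_potential (G : 'rV[R]_n -> R) (f g : 'rV[R]_n -> R[i])
    (x : 'rV[R]_n) : R[i] :=
  integralC (lebesgueN n) (fun y => (G y)%:C * f (x - y) * g (x + y)).

End bessel.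

Section norms.
Context {R : realType} {n : nat}.
Implicit Types h : 'rV[R]_n -> R[i].

Local Notation modulus := complex.ComplexField.Normc.normc.

Definition Lpnorm (p : \bar R) h : \bar R :=
  Lnorm (lebesgueN n) p (fun x => (modulus (h x))%:E).

Definition distribution_fun h (lambda : R) : \bar R :=
  lebesgueN n [set x | lambda < modulus (h x)].

Definition rearrangement h (t : R) : \bar R :=
  ereal_inf [set lambda%:E | lambda in
    [set lambda : R | 0 < lambda /\ (distribution_fun h lambda <= t%:E)%E]].

Definition weakLnorm (r : R) h : \bar R :=
  ereal_sup [set ((t `^ r^-1)%:E * rearrangement h t)%E | t in
    [set t : R | 0 < t]].

End norms.

(* Main.v *)
Require Import Defs.
From HB Require Import structures.
From mathcomp Require Import all_boot all_order all_algebra.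
From mathcomp Require Import all_classical all_reals all_analysis.
From mathcomp Require Import measurable_realfun complex.
From mathcomp Require Import ess_sup_inf ring lra.

Set Implicit Arguments.
Unset Strict Implicit.
Unset Printing Implicit Defensive.

Import Order.TTheory GRing.Theory Num.Theory.
Import numFieldNormedType.Exports.

Local Open Scope classical_set_scope.
Local Open Scope ring_scope.

(** Gaussians alone force both inequalities.

    Take f = g = exp (- d^2 |x|^2).  By the parallelogram identity
    |x - y|^2 + |x + y|^2 = 2 |x|^2 + 2 |y|^2, the product f (x - y) g (x + y)
    separates, and the potential is again a Gaussian
      J_s (f, f) (x) = c(d) exp (- 2 d^2 |x|^2),
      c(d) = int G_s (y) exp (- 2 d^2 |y|^2) dy
    ([bilinear_potential_gauss]).  Both sides of the assumed bound now scale in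
    an explicit way: the weak norm is at least a constant times
    c(d) d^(- n / r) ([weakLnorm_gauss_lb]), and the product of the two norms on
    the right is at most a constant times d^(- n (1 / p + 1 / q))
    ([Lpnorm_gauss_ub]).  Hence
      c(d) d^(- n / r) <= const d^(- n (1 / p + 1 / q))  for all d > 0.

    As d tends to 0, c(d) stays bounded below because it is nonincreasing in d,
    and comparing exponents gives 1 / r <= 1 / p + 1 / q.

    As d tends to infinity, c(d) >= k d^(- s) ([bessel_gauss_lb]), and comparing
    exponents gives 1 / p + 1 / q - s / n <= 1 / r.  This lower bound is where
    the Bessel kernel enters.  A Gaussian is the Fourier transform of a Gaussian
    density, so Tonelli's theorem moves the transform onto G_s:
      c(d) = int Gamma (xi) (1 + 4 pi^2 |xi|^2)^(- s / 2) dxi,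
    with Gamma the centred normal density of standard deviation tau = d / pi in
    each coordinate ([integral_bessel_gauss]).  On the cube of half-side tau,
    which carries a fixed share of the mass of Gamma, the symbol is of size at
    least d^(- s) as soon as d >= 1.

    The characteristic function of the normal density is computed on the line by
    the differential equation F' (y) = - tau^2 y F (y), and is carried to R^n by
    induction on n.  The induction and the exchange of integrals use the
    integrands weight * (1 + b cos (c + y . x)) with |b| <= 1 instead of complex
    exponentials: they are nonnegative, so Tonelli's theorem applies throughout,
    and the phase c makes the family stable when one coordinate is integrated
    out. *)

(** * The characteristic function of the normal density on the line *)

Lemma ler_abs_expR_sqr {R : realType} (e t : R) : 0 < e ->
  `|t| <= (1 + e^-1) * expR (e * t ^+ 2).
Proof.
move=> e0.
have h1 : `|t| <= 1 + t ^+ 2.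
  rewrite -(real_normK (num_real t)); nra.
apply: (le_trans h1).
apply: (@le_trans _ _ ((1 + e^-1) * (1 + e * t ^+ 2))); last first.
  by rewrite ler_pM2l ?expR_ge1Dx// addr_gt0 ?invr_gt0.
have -> : (1 + e^-1) * (1 + e * t ^+ 2) = 1 + t ^+ 2 + (e * t ^+ 2 + e^-1).
  by field; rewrite gt_eqF.
rewrite lerDl; apply: addr_ge0; last by rewrite invr_ge0 ltW.
by apply: mulr_ge0; rewrite ?sqr_ge0 ?ltW.
Qed.

Section gaussian_line.
Context {R : realType}.
Local Notation mu := (@lebesgue_measure R).
Variable tau : R.
Hypothesis tau0 : 0 < tau.
Local Notation phi := (normal_pdf 0 tau).

Let tau_neq0 : tau != 0. Proof. by rewrite gt_eqF. Qed.

Lemma normal_pdf0E (t : R) : phi t = normal_peak tau * expR (- t ^+ 2 / (tau ^+ 2 *+ 2)).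
Proof. by rewrite normal_pdfE ?gt_eqF// /normal_fun subr0. Qed.

Lemma is_derive_normal_pdf0 (t : R) : is_derive t 1 phi (- (t / tau ^+ 2) * phi t).
Proof.
rewrite (_ : phi = fun t => normal_peak tau * expR (- t ^+ 2 / (tau ^+ 2 *+ 2))); last first.
  by apply/funext => x; rewrite normal_pdf0E.
apply: is_derive_eq.
rewrite /= !(scaler0, add0r, addr0, scaler1, scale0r) /GRing.scale/=.
rewrite !mulr2n; field.
by rewrite tau_neq0 -mulr2n mulrn_eq0 sqrf_eq0.
Qed.

(** A moment costs only an enlargement of the variance: the factor |t| is
    absorbed by part of the exponent. *)
Lemma normal_pdf0_abs_le : exists2 M, 0 < M & forall t,
  `|t| * phi t <= M * normal_pdf 0 (tau *+ 2) t.
Proof.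
(* 1 / (2 tau^2) - 3 / (8 tau^2) = 1 / (2 (2 tau)^2) *)
set e := 3 / (8 * tau ^+ 2).
have e0 : 0 < e by rewrite divr_gt0// mulr_gt0// exprn_gt0.
have tau20 : tau *+ 2 != 0 by rewrite mulrn_eq0.
exists ((1 + e^-1) * normal_peak tau / normal_peak (tau *+ 2)).
  apply: divr_gt0; last exact: normal_peak_gt0.
  apply: mulr_gt0; last exact: normal_peak_gt0.
  by apply: addr_gt0; rewrite // invr_gt0.
move=> t; rewrite normal_pdf0E (@normal_pdfE _ 0 (tau *+ 2))// /normal_fun subr0.
have -> x y z w : (x * y / z) * (z * w) = y * (x * (w * (z^-1 * z))) :> R by ring.
rewrite mulVf ?gt_eqF ?normal_peak_gt0//.
rewrite mulrCA ler_pM2l ?normal_peak_gt0// mulr1.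
have -> : expR (- t ^+ 2 / ((tau *+ 2) ^+ 2 *+ 2)) =
   expR (e * t ^+ 2) * expR (- t ^+ 2 / (tau ^+ 2 *+ 2)).
  rewrite -expRD; congr expR; rewrite /e !mulr2n; field.
  by rewrite -!mulr2n !(mulrn_eq0, sqrf_eq0) (negPf tau_neq0).
rewrite mulrA ler_pM2r ?expR_gt0//.
exact: ler_abs_expR_sqr.
Qed.

Lemma integrable_normal_pdf_mul (h : R -> R) (a b : R) :
  measurable_fun setT h -> (forall t, `|h t| <= a * `|t| + b) ->
  mu.-integrable setT (fun t => (phi t * h t)%:E).
Proof.
move=> mh hb; have [M M0 HM] := normal_pdf0_abs_le.
pose g t := `|a| * M * normal_pdf 0 (tau *+ 2) t + `|b| * phi t.
have ig : mu.-integrable setT (fun t => (g t)%:E).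
  rewrite (_ : (fun t => _) = (fun t => ((`|a| * M)%:E * (normal_pdf 0 (tau *+ 2) t)%:E +
     (`|b|)%:E * (phi t)%:E)%E)); last by apply/funext => t; rewrite /g EFinD !EFinM.
  by apply: integrableD => //; apply: integrableZl => //; exact: integrable_normal_pdf.
apply: (le_integrable _ _ _ ig) => //.
  by apply/measurable_EFinP/measurable_funM => //; exact: measurable_normal_pdf.
move=> t _; rewrite /= lee_fin normrM (ger0_norm (normal_pdf_ge0 _ _ _)).
apply: (le_trans _ (ler_norm _)).
apply: (@le_trans _ _ (phi t * (`|a| * `|t| + `|b|))).
  apply: ler_wpM2l; first exact: normal_pdf_ge0.
  apply: (le_trans (hb t)); apply: lerD; last exact: ler_norm.
  by apply: ler_wpM2r => //; exact: ler_norm.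
rewrite /g mulrDr [in leRHS](mulrC `|b|) lerD2r mulrCA -mulrA.
by apply: ler_wpM2l => //; rewrite mulrC.
Qed.

Lemma cvg_normal_pdf0 : phi n.+1%:R @[n --> \oo] --> 0.
Proof.
have [M M0 HM] := normal_pdf0_abs_le.
have t20 : tau *+ 2 != 0 by rewrite mulrn_eq0.
have h : (M * normal_peak (tau *+ 2)) * (n.+1%:R)^-1 @[n --> \oo] --> (M * normal_peak (tau *+ 2)) * 0.
  by apply: cvgMr; exact: cvg_harmonic.
rewrite mulr0 in h.
apply: (squeeze_cvgr _ (cvg_cst 0) h).
apply: nearW => n; rewrite normal_pdf_ge0/= ler_pdivlMr// mulrC.
have := HM n.+1%:R; rewrite ger0_norm// => /le_trans; apply.
by rewrite ler_pM2l// normal_pdf_ub.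
Qed.

(** The domination by the normal density makes the boundary terms of the
    fundamental theorem of calculus on [- N, N] vanish as N grows. *)
Lemma Rintegral_derive0 (H h : R -> R) :
  (forall t : R, is_derive t 1 H (h t)) -> continuous h ->
  mu.-integrable setT (EFin \o h) -> (forall t, `|H t| <= phi t) ->
  \int[mu]_t h t = 0.
Proof.
move=> dH ch ih HM.
have cH : continuous H.
  move=> t; apply: differentiable_continuous; apply/derivable1_diffP.
  by have [] := dH t.
pose A n := [set` `[- n.+1%:R, n.+1%:R : R]].
have cvgA : (\int[mu]_(t in A n) (h t)%:E)%E @[n --> \oo] --> (\int[mu]_t (h t)%:E)%E.
  rewrite (_ : (fun n => _) = (fun n => (\int[mu]_t (((h \_ (A n)) t)%:E))%E)); last first.
    apply/funext => n; rewrite integral_mkcond; apply: eq_integral => t _.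
    by rewrite restrict_EFin.
  apply: (@dominated_cvg _ _ _ mu _ _ _ _ (fun t => `|h t|%:E)) => //.
  - move=> n; apply/measurable_EFinP; apply/(measurable_restrictT _ _).1 => //.
      exact: measurable_itv.
    by apply: measurable_funTS; exact: continuous_measurable_fun.
  - move=> t _; apply: cvg_EFin; first exact: nearW.
    apply: cvg_near_cst.
    near=> n; rewrite /comp patchT ?inE//= /A /= in_itv/= -ler_norml.
    apply: (@le_trans _ _ n%:R); last by rewrite ler_nat.
    by near: n; exact: nbhs_infty_ger.
  - exact: integrable_abse ih.
  - move=> n t _; rewrite lee_fin /patch; case: ifPn => // _.
    by rewrite normr0.
have cvg0 : (\int[mu]_(t in A n) (h t)%:E)%E @[n --> \oo] --> 0%E.
  rewrite (_ : (fun n => _) = (fun n => (H n.+1%:R - H (- n.+1%:R))%:E)); last first.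
    apply/funext => n; rewrite (@continuous_FTC2 _ h H)//.
    - by rewrite gtrN.
    - by apply: continuous_subspaceT.
    - split => [t _| |].
      + by have [] := dH t.
      + by apply: cvg_at_right_filter; exact: cH.
      + by apply: cvg_at_left_filter; exact: cH.
    - by move=> t _; rewrite derive1E; have [_] := dH t.
  apply: cvg_EFin; first exact: nearW.
  have hh : (phi n.+1%:R *+ 2) @[n --> \oo] --> (0 : R) *+ 2.
    by apply: cvgMn; exact: cvg_normal_pdf0.
  rewrite mul0rn in hh; apply: norm_cvg0.
  apply: (squeeze_cvgr _ (cvg_cst 0) hh).
  apply: nearW => n; rewrite normr_ge0/= (le_trans (ler_normB _ _))// mulr2n.
  rewrite lerD// (le_trans (HM _))// !normal_pdf0E sqrrN.
  by [].
have := cvg_unique _ cvgA cvg0.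
by rewrite /Rintegral => -> //.
Unshelve. all: by end_near. Qed.

(** As a function of y the integral F satisfies F (0) = cos c and
    F' (y) = - tau^2 y F (y): its derivative brings down a factor - t, which is
    traded for the derivative of the density, phi' (t) = - t phi (t) / tau^2, and
    an integration by parts. *)
Lemma Rintegral_normal_pdf0_cos (c y : R) :
  \int[mu]_t (phi t * cos (c + y * t)) = cos c * expR (- (tau ^+ 2 * y ^+ 2) / 2).
Proof.
pose f (y t : R) := phi t * cos (c + y * t).
pose F (y : R) := \int[mu]_t f y t.
have cphi : continuous phi by exact: continuous_normal_pdf.
have clin z : continuous (fun t : R => c + z * t).
  move=> t; apply: cvgD; first exact: cvg_cst.
  by apply: cvgM; [exact: cvg_cst|exact: cvg_id].
have ccos z : continuous (fun t : R => cos (c + z * t)).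
  by move=> t; apply: (cvg_comp _ _ (clin z t)); exact: continuous_cos.
have csin z : continuous (fun t : R => sin (c + z * t)).
  by move=> t; apply: (cvg_comp _ _ (clin z t)); exact: continuous_sin.
have intf z : mu.-integrable setT (EFin \o f z).
  apply: (@integrable_normal_pdf_mul _ 0 1); first exact: continuous_measurable_fun.
  by move=> t; rewrite mul0r add0r cos_max.
have dcosy (z t : R) : is_derive z 1 (f ^~ t) (- (phi t * (t * sin (c + z * t)))).
  rewrite /f; apply: is_derive_eq.
  rewrite /= !(scaler0, add0r, addr0, scaler1, scale0r) /GRing.scale/=; ring.
have ints z : mu.-integrable setT (EFin \o (fun t => phi t * (t * sin (c + z * t)))).
  apply: (@integrable_normal_pdf_mul _ 1 0).
    by apply: measurable_funM => //; exact: continuous_measurable_fun.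
  move=> t; rewrite mul1r addr0 normrM ler_piMr//.
  exact: sin_max.
have [M M0 HM] := normal_pdf0_abs_le.
have dF (z : R) : is_derive z 1 F (- \int[mu]_t (phi t * (t * sin (c + z * t)))).
  pose G t := M * normal_pdf 0 (tau *+ 2) t.
  have Iz : [set` `]z - 1, z + 1[] z by rewrite /= in_itv/= ltrBlDr ltrDl ltr01.
  have G0 t : 0 <= G t by rewrite mulr_ge0 ?normal_pdf_ge0 ?ltW.
  have iG : mu.-integrable setT (EFin \o G).
    rewrite (_ : EFin \o G = (fun t => M%:E * (normal_pdf 0 (tau *+ 2) t)%:E)%E)//.
    by apply: integrableZl => //; exact: integrable_normal_pdf.
  have derf x t : [set` `]z - 1, z + 1[] x -> setT t -> derivable (f ^~ t) x 1.
    by move=> _ _; have [] := dcosy x t.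
  have ubG x t : [set` `]z - 1, z + 1[] x -> setT t -> `|partial1of2 f x t| <= G t.
    move=> _ _; rewrite partial1of2E; have [_ ->] := dcosy x t.
    rewrite normrN normrM (ger0_norm (normal_pdf_ge0 _ _ _)) normrM.
    apply: (le_trans _ (HM t)); rewrite mulrC; apply: ler_wpM2r.
      exact: normal_pdf_ge0.
    by rewrite ler_piMr// sin_max.
  have der := @derivable_under_integral R _ _ mu f setT measurableT z _ _ Iz
     (fun x _ => intf x) derf G G0 iG ubG.
  have derE := @differentiation_under_integral R _ _ mu f setT measurableT z _ _ Iz
     (fun x _ => intf x) derf G G0 iG ubG.
  apply: DeriveDef => //; rewrite -derive1E derE.
  under eq_Rintegral => t _ do rewrite partial1of2E (@derive_val _ _ _ _ _ _ _ (dcosy z t)) -mulN1r.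
  by rewrite RintegralZl// mulN1r.
have parts z : \int[mu]_t (phi t * (t * sin (c + z * t))) = tau ^+ 2 * z * F z.
  pose H t := phi t * sin (c + z * t).
  pose h t := - (tau ^- 2) * (phi t * (t * sin (c + z * t))) + z * f z t.
  have dH (t : R) : is_derive t 1 H (h t).
    have dphi := is_derive_normal_pdf0 t.
    have dsin : is_derive t 1 (fun t : R => sin (c + z * t)) (z * cos (c + z * t)).
      by apply: is_derive_eq; rewrite !(scaler0, add0r, addr0, scaler1, scale0r) /GRing.scale/=; ring.
    apply: (is_derive_eq (is_deriveM dphi dsin)).
    rewrite /GRing.scale/= /h /f; field.
    exact: tau_neq0.
  have ch : continuous h.
    move=> t; apply: cvgD; apply: cvgM; try exact: cvg_cst.
      apply: cvgM; first exact: cphi.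
      by apply: cvgM; [exact: cvg_id|exact: csin].
    by apply: cvgM; [exact: cphi|exact: ccos].
  have ih1 : mu.-integrable setT (EFin \o (fun t => - (tau ^- 2) * (phi t * (t * sin (c + z * t))))).
    rewrite (_ : EFin \o _ = (fun t => (- (tau ^- 2))%:E * (phi t * (t * sin (c + z * t)))%:E)%E)//.
    by apply: integrableZl => //; exact: ints.
  have ih2 : mu.-integrable setT (EFin \o (fun t => z * f z t)).
    rewrite (_ : EFin \o _ = (fun t => z%:E * (f z t)%:E)%E)//.
    by apply: integrableZl => //; exact: intf.
  have ih : mu.-integrable setT (EFin \o h).
    exact: (integrableD measurableT ih1 ih2).
  have HM' t : `|H t| <= phi t.
    rewrite normrM (ger0_norm (normal_pdf_ge0 _ _ _)) ler_piMr ?normal_pdf_ge0//.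
    exact: sin_max.
  have := Rintegral_derive0 dH ch ih HM'.
  rewrite /h RintegralD// RintegralZl//.
  rewrite RintegralZl// -/(F z) => /eqP; rewrite mulNr addrC subr_eq0 => /eqP zF.
  by rewrite -mulrA zF mulrA divff ?mul1r// sqrf_eq0.
(* E is constant by the differential equation *)
pose E (z : R) := expR (tau ^+ 2 * z ^+ 2 / 2) * F z.
have dE (z : R) : is_derive z 1 E 0.
  have dFz := dF z.
  have de : is_derive z 1 (fun z : R => expR (tau ^+ 2 * z ^+ 2 / 2))
      (tau ^+ 2 * z * expR (tau ^+ 2 * z ^+ 2 / 2)).
    apply: is_derive_eq.
    by rewrite !(scaler0, add0r, addr0, scaler1, scale0r) /GRing.scale/=; field.
  apply: (is_derive_eq (is_deriveM de dFz)).
  by rewrite parts /GRing.scale/=; ring.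
have EE : E y = E 0 by apply: is_derive_0_is_cst.
have F0 : F 0 = cos c.
  rewrite /F /f; under eq_Rintegral => t _ do rewrite mul0r addr0 mulrC.
  rewrite RintegralZl//; last exact: integrable_normal_pdf.
  by rewrite /Rintegral integral_normal_pdf/= mulr1.
move: EE; rewrite /E F0 expr0n/= mulr0 mul0r expR0 mul1r => <-.
by rewrite -/(F y) mulrAC -expRD mulNr addrN expR0 mul1r.
Qed.

Lemma integral_normal_pdf0_cos (b c y : R) : `|b| <= 1 ->
  (\int[mu]_t (phi t * (1 + b * cos (c + y * t)))%:E)%E =
  (1 + b * (cos c * expR (- (tau ^+ 2 * y ^+ 2) / 2)))%:E.
Proof.
move=> b1.
have mcos : measurable_fun setT (fun t : R => cos (c + y * t)).
  apply: continuous_measurable_fun => t.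
  apply: (cvg_comp (fun t : R => c + y * t) cos); last exact: continuous_cos.
  apply: cvgD; first exact: cvg_cst.
  by apply: cvgM; [exact: cvg_cst|exact: cvg_id].
have ic : mu.-integrable setT (fun t => (phi t * cos (c + y * t))%:E).
  apply: (@integrable_normal_pdf_mul _ 0 1) => // t.
  by rewrite mul0r add0r cos_max.
under eq_integral => t _ do rewrite mulrDr mulr1 mulrCA EFinD EFinM.
rewrite integralD//; [|exact: integrable_normal_pdf|exact: integrableZl].
rewrite integral_normal_pdf integralZl// EFinD EFinM; congr (_ + _ * _)%E.
rewrite -Rintegral_normal_pdf0_cos /Rintegral fineK//.
exact: integrable_fin_num.
Qed.

End gaussian_line.

(** * Normal densities on the Euclidean space *)

Section lebesgueN_integral.
Context {R : realType}.
Local Notation mu := (@lebesgue_measure R).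

Lemma ge0_integral_lebesgueS n (f : 'rV[R]_n.+1 -> \bar R) :
  measurable_fun setT f -> (forall x, 0 <= f x)%E ->
  (\int[lebesgueN n.+1]_x f x =
   \int[mu]_t \int[lebesgueN n]_y f (rV_cons (t, y)))%E.
Proof.
move=> mf f0.
transitivity (\int[mu \x lebesgueN n]_z (f \o @rV_cons R n) z)%E.
  exact: (@ge0_integral_pushforward _ _ _ _ _ _ (@measurable_rV_cons R n) _ setT f).
rewrite (@fubini_tonelli1 _ _ _ _ R mu (lebesgueN n) (f \o @rV_cons R n))//; last first.
  by move=> z; exact: f0.
exact: measurableT_comp mf (@measurable_rV_cons R n).
Qed.

Lemma measurable_dotrV n (y : 'rV[R]_n) : measurable_fun setT (dotrV y).
Proof.
apply: measurable_sum => i; apply: measurable_funM => //.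
exact: measurable_coord.
Qed.

Lemma measurable_dotrVxx n : measurable_fun setT (fun x : 'rV[R]_n => dotrV x x).
Proof.
by apply: measurable_sum => i; apply: measurable_funM; exact: measurable_coord.
Qed.

Lemma dotrV_cons n (y : 'rV[R]_n.+1) (t : R) x :
  dotrV y (rV_cons (t, x)) = y ord0 ord0 * t + dotrV (\row_j y ord0 (lift ord0 j)) x.
Proof.
rewrite /dotrV big_ord_recl !mxE unlift_none; congr (_ + _).
by apply: eq_bigr => i _; rewrite !mxE liftK.
Qed.

Definition normal_pdfN n (tau : R) (x : 'rV[R]_n) : R :=
  \prod_(i < n) normal_pdf 0 tau (x ord0 i).

Lemma normal_pdfN_ge0 n (tau : R) (x : 'rV[R]_n) : 0 <= normal_pdfN tau x.
Proof. by apply: prodr_ge0 => i _; exact: normal_pdf_ge0. Qed.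

Lemma measurable_normal_pdfN n tau : measurable_fun setT (@normal_pdfN n tau).
Proof.
apply: measurable_prod => i _.
apply: (measurableT_comp (measurable_normal_pdf _ _)); exact: measurable_coord.
Qed.

Lemma normal_pdfN_cons n tau (t : R) (x : 'rV[R]_n) :
  normal_pdfN tau (rV_cons (t, x)) = normal_pdf 0 tau t * normal_pdfN tau x.
Proof.
rewrite /normal_pdfN big_ord_recl !mxE unlift_none; congr (_ * _).
by apply: eq_bigr => i _; rewrite !mxE liftK.
Qed.

Lemma measurable_normal_pdfN_cos n tau (b c : R) (y : 'rV[R]_n) :
  measurable_fun setT (fun x => normal_pdfN tau x * (1 + b * cos (c + dotrV y x))).
Proof.
apply: measurable_funM; first exact: measurable_normal_pdfN.
apply: measurable_funD => //; apply: measurable_funM => //.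
apply: (measurableT_comp (continuous_measurable_fun (@continuous_cos R))).
by apply: measurable_funD => //; exact: measurable_dotrV.
Qed.

Lemma normal_pdfN_cos_ge0 n tau (b c : R) (y x : 'rV[R]_n) : `|b| <= 1 ->
  0 <= normal_pdfN tau x * (1 + b * cos (c + dotrV y x)).
Proof.
move=> b1; apply: mulr_ge0; first exact: normal_pdfN_ge0.
have : `|b * cos (c + dotrV y x)| <= 1 by rewrite normrM mulr_ile1// cos_max.
by rewrite ler_norml => /andP[+ _]; lra.
Qed.

(** In the induction, integrating out all coordinates but the first multiplies b
    by a factor in [0, 1] and leaves the remaining phase c + y_0 t; this is why
    the amplitude b and the phase c are kept general. *)
Lemma integral_normal_pdfN_cos n (tau b c : R) (y : 'rV[R]_n) :
  0 < tau -> `|b| <= 1 ->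
  (\int[lebesgueN n]_x (normal_pdfN tau x * (1 + b * cos (c + dotrV y x)))%:E =
  (1 + b * (cos c * expR (- (tau ^+ 2 * dotrV y y) / 2)))%:E)%E.
Proof.
move=> tau0; elim: n b c y => [|n IHn] b c y b1.
  rewrite integral_dirac//; last first.
    by apply/measurable_EFinP; exact: measurable_normal_pdfN_cos.
  rewrite diracT mul1e /normal_pdfN /dotrV !big_ord0.
  by rewrite mul1r mulr0 oppr0 mul0r expR0 mulr1 addr0.
rewrite ge0_integral_lebesgueS//; first last.
- by move=> x; rewrite lee_fin normal_pdfN_cos_ge0.
- by apply/measurable_EFinP; exact: measurable_normal_pdfN_cos.
set y' := \row_j y ord0 (lift ord0 j).
set E := expR (- (tau ^+ 2 * dotrV y' y') / 2).
have E1 : `|b * E| <= 1.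
  rewrite normrM mulr_ile1// ger0_norm ?expR_ge0// -expR0 ler_expR mulNr oppr_le0.
  rewrite divr_ge0// mulr_ge0 ?sqr_ge0// sumr_ge0// => i _.
  by rewrite -expr2 sqr_ge0.
transitivity (\int[mu]_t (normal_pdf 0 tau t *
    (1 + (b * E) * cos (c + y ord0 ord0 * t)))%:E)%E.
  apply: eq_integral => t _.
  under eq_integral => x _ do
    rewrite normal_pdfN_cons dotrV_cons addrA -mulrA EFinM.
  rewrite ge0_integralZl//=.
  - rewrite IHn// -EFinM; congr (_ * _)%:E; rewrite -/E; ring.
  - by apply/measurable_EFinP; exact: measurable_normal_pdfN_cos.
  - by move=> x _; rewrite lee_fin normal_pdfN_cos_ge0.
  - by rewrite lee_fin normal_pdf_ge0.
rewrite integral_normal_pdf0_cos//; congr (1 + _)%:E.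
rewrite [dotrV y y](_ : _ = y ord0 ord0 ^+ 2 + dotrV y' y'); last first.
  rewrite /dotrV big_ord_recl expr2; congr (_ + _).
  by apply: eq_bigr => i _; rewrite !mxE.
rewrite mulrDr opprD mulrDl expRD -/E; ring.
Qed.

Lemma integral_normal_pdfN n (tau : R) : 0 < tau ->
  (\int[lebesgueN n]_x (normal_pdfN tau x)%:E = 1)%E.
Proof.
move=> tau0; have := @integral_normal_pdfN_cos n tau 0 0 0 tau0.
rewrite normr0 ler01 => /(_ isT); rewrite mul0r addr0 => <-.
by apply: eq_integral => x _; rewrite mul0r addr0 mulr1.
Qed.

End lebesgueN_integral.

(** * Gaussians and cubes in the Euclidean space *)

Section gaussian_cube.
Context {R : realType} {n : nat}.
Local Notation mun := (@lebesgueN R n).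

Lemma dotrV_ge0 (x : 'rV[R]_n) : 0 <= dotrV x x.
Proof. by apply: sumr_ge0 => i _; rewrite -expr2 sqr_ge0. Qed.

Definition gaussN (a : R) (x : 'rV[R]_n) : R := expR (- (a * dotrV x x)).

Lemma measurable_gaussN a : measurable_fun setT (gaussN a).
Proof.
apply: (measurableT_comp (@measurable_expR R)).
apply: measurable_funN; apply: measurable_funM => //; exact: measurable_dotrVxx.
Qed.

Lemma gaussN_ge0 a x : 0 <= gaussN a x. Proof. exact: expR_ge0. Qed.

Lemma gaussN_le1 a x : 0 <= a -> gaussN a x <= 1.
Proof.
by move=> a0; rewrite -expR0 ler_expR oppr_le0 mulr_ge0 ?dotrV_ge0.
Qed.

Lemma gaussN_parallelogram a (x y : 'rV[R]_n) :
  gaussN a (x - y) * gaussN a (x + y) = gaussN (2 * a) x * gaussN (2 * a) y.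
Proof.
have D : dotrV (x - y) (x - y) + dotrV (x + y) (x + y) =
    2 * (dotrV x x + dotrV y y).
  rewrite /dotrV -!big_split/= mulr_sumr; apply: eq_bigr => i _.
  by rewrite !mxE; ring.
rewrite /gaussN -!expRD; congr expR.
by rewrite -opprD -mulrDr D; ring.
Qed.

Lemma normal_peakE (tau : R) : 0 < tau -> normal_peak tau = normal_peak 1 / tau.
Proof.
move=> t0; rewrite /normal_peak expr1n mul1r -invfM; congr _^-1.
by rewrite -mulrnAr sqrtrM ?sqr_ge0// sqrtr_sqr gtr0_norm// mulrC.
Qed.

Lemma integral_gaussN (b : R) : 0 < b ->
  (\int[mun]_x (gaussN b x)%:E = ((Num.sqrt (pi / b)) ^+ n)%:E)%E.
Proof.
move=> b0; pose tau := (Num.sqrt (2 * b))^-1.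
have tau0 : 0 < tau by rewrite invr_gt0 sqrtr_gt0 mulr_gt0.
have pk0 : 0 < normal_peak tau by rewrite normal_peak_gt0// lt0r_neq0.
have tau2 : tau ^+ 2 = (2 * b)^-1 by rewrite exprVn sqr_sqrtr// mulr_ge0// ltW.
have E (x : 'rV[R]_n) : (gaussN b x)%:E = (((normal_peak tau)^-1 ^+ n)%:E * (normal_pdfN tau x)%:E)%E.
  rewrite -EFinM; congr EFin.
  have -> : (normal_peak tau)^-1 ^+ n = \prod_(i < n) (normal_peak tau)^-1.
    by rewrite prodr_const card_ord.
  rewrite /normal_pdfN -big_split/=.
  rewrite /gaussN /dotrV mulr_sumr -sumrN expR_sum; apply: eq_bigr => i _.
  rewrite normal_pdf0E// mulKf ?gt_eqF// tau2; congr expR.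
  by rewrite mulr2n; field; exact: lt0r_neq0.
under eq_integral do rewrite E.
rewrite ge0_integralZl//=.
- rewrite integral_normal_pdfN// mule1 /normal_peak invrK tau2; congr (_ ^+ _)%:E.
  by congr Num.sqrt; rewrite mulr2n; move: (@pi R) => P; field; exact: lt0r_neq0.
- by apply/measurable_EFinP; exact: measurable_normal_pdfN.
- by move=> x _; rewrite lee_fin normal_pdfN_ge0.
- by rewrite lee_fin exprn_ge0// invr_ge0 ltW.
Qed.

Lemma lebesgueN_cube (b : R) : 0 <= b ->
  mun [set x | forall i, [set` `[- b, b]] (x ord0 i)] = ((2 * b) ^+ n)%:E.
Proof.
move=> b0; rewrite (lebesgueN_box (A := fun=> _)) => [|i]; last exact: measurable_itv.
rewrite (eq_bigr (fun=> (2 * b)%:E)) => [|i _].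
  by rewrite prodEFin prodr_const card_ord.
rewrite lebesgue_measure_itv/= lte_fin; case: ltP => [_|h].
  by rewrite -EFinD; congr EFin; lra.
by congr EFin; lra.
Qed.

Lemma measurable_cube (b : R) :
  measurable [set x : 'rV[R]_n | forall i, [set` `[- b, b]] (x ord0 i)].
Proof. by apply: (measurable_rV_box (A := fun=> _)) => i; exact: measurable_itv. Qed.

Lemma dotrV_cube (b : R) (x : 'rV[R]_n) :
  (forall i, [set` `[- b, b]] (x ord0 i)) -> dotrV x x <= n%:R * b ^+ 2.
Proof.
move=> xb; apply: (@le_trans _ _ (\sum_(i < n) b ^+ 2)).
  apply: ler_sum => i _; have := xb i; rewrite /= in_itv/= => /andP[h1 h2]; nra.
by rewrite sumr_const card_ord mulr_natl.
Qed.

End gaussian_cube.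

(** * The Bessel kernel integrated against a Gaussian *)

Section bessel_gaussian.
Context {R : realType} {n : nat}.
Local Notation mun := (@lebesgueN R n).
Variables (s : R) (G : 'rV[R]_n -> R).
Hypothesis bG : is_bessel_kernel s G.

(* the Fourier transform of the Bessel kernel *)
Local Notation symb xi := ((1 + 4 * pi ^+ 2 * dotrV xi xi) `^ (- (s / 2))).

Lemma measurable_bessel : measurable_fun setT G.
Proof. by have [_ /integrableP[/measurable_EFinP]] := bG. Qed.

Lemma integrable_bessel_mul (h : 'rV[R]_n -> R) :
  measurable_fun setT h -> (forall x, `|h x| <= 1) ->
  mun.-integrable setT (fun x => (G x * h x)%:E).
Proof.
move=> mh h1; have [G0 iG _] := bG.
apply: (le_integrable _ _ _ iG) => //.
  by apply/measurable_EFinP/measurable_funM => //; exact: measurable_bessel.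
by move=> x _; rewrite /= lee_fin normrM ler_piMr.
Qed.

Lemma measurable_cos_dotrV (x : 'rV[R]_n) :
  measurable_fun setT (fun y : 'rV[R]_n => cos (2 * pi * dotrV y x)).
Proof.
apply: (measurableT_comp (continuous_measurable_fun (@continuous_cos R))).
apply: measurable_funM => //; apply: measurable_sum => i; apply: measurable_funM => //.
exact: measurable_coord.
Qed.

Lemma integral_bessel_cos xi :
  (\int[mun]_x (G x * cos (2 * pi * dotrV x xi))%:E = (symb xi)%:E)%E.
Proof.
have [G0 iG /(_ xi)] := bG.
rewrite /fourier /integralC => /(congr1 (@complex.Re R)) /=.
rewrite /enorm sqr_sqrtr ?dotrV_ge0// => <-.
rewrite /Rintegral fineK.
  by apply: eq_integral => x _; rewrite cosN mul0r subr0.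
apply: integrable_fin_num => //.
rewrite (_ : (fun x => _) = (fun x => (G x * cos (2 * pi * dotrV x xi))%:E)).
  apply: integrable_bessel_mul; first exact: measurable_cos_dotrV.
  by move=> x; exact: cos_max.
by apply/funext => x; rewrite cosN mul0r subr0.
Qed.

(** The value of the Fourier transform at 0. *)
Lemma integral_bessel : (\int[mun]_x (G x)%:E = 1)%E.
Proof.
have := integral_bessel_cos 0.
rewrite [dotrV _ _]big1 => [|i _]; last by rewrite !mxE mul0r.
rewrite mulr0 addr0 powR1 => <-; apply: eq_integral => x _.
by rewrite [dotrV _ _]big1 => [|i _]; rewrite ?mulr0 ?cos0 ?mulr1// !mxE mulr0.
Qed.

Lemma integrable_bessel_gauss a : 0 <= a ->
  mun.-integrable setT (fun x => (G x * gaussN a x)%:E).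
Proof.
move=> a0; apply: integrable_bessel_mul; first exact: measurable_gaussN.
by move=> x; rewrite ger0_norm ?gaussN_ge0// gaussN_le1.
Qed.

Let measurable_coord_fst i :
  measurable_fun setT (fun z : 'rV[R]_n * 'rV[R]_n => z.1 ord0 i).
Proof. exact: measurableT_comp (measurable_coord i) measurable_fst. Qed.

Let measurable_coord_snd i :
  measurable_fun setT (fun z : 'rV[R]_n * 'rV[R]_n => z.2 ord0 i).
Proof. exact: measurableT_comp (measurable_coord i) measurable_snd. Qed.

Lemma symb_ge0 (xi : 'rV[R]_n) : 0 <= symb xi. Proof. exact: powR_ge0. Qed.

Lemma measurable_symb : measurable_fun setT (fun xi : 'rV[R]_n => symb xi).
Proof.
apply: (measurableT_comp (measurable_powR _)).
apply: measurable_funD => //; apply: measurable_funM => //; exact: measurable_dotrVxx.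
Qed.

(** Both sides, increased by 1, are the two iterated integrals of
    G (x) Gamma (xi) (1 + cos (2 pi x . xi)).  The added 1 keeps the integrand
    nonnegative, and each of its two iterated integrals contributes 1 because G
    and Gamma have total mass 1. *)
Lemma integral_bessel_gauss tau : 0 < tau ->
  (\int[mun]_x (G x * gaussN (2 * pi ^+ 2 * tau ^+ 2) x)%:E =
   \int[mun]_xi (normal_pdfN tau xi * symb xi)%:E)%E.
Proof.
move=> tau0; have [G0 iG _] := bG.
pose K (z : 'rV[R]_n * 'rV[R]_n) : R :=
  G z.1 * (normal_pdfN tau z.2 * (1 + 1 * cos (0 + dotrV ((2 * pi) *: z.1) z.2))).
have K0 z : 0 <= K z.
  by rewrite /K mulr_ge0// normal_pdfN_cos_ge0// normr1.
have mK : measurable_fun setT K.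
  apply: measurable_funM; first exact: measurableT_comp measurable_bessel measurable_fst.
  apply: measurable_funM.
    exact: (measurableT_comp (@measurable_normal_pdfN R n tau) measurable_snd).
  apply: measurable_funD => //; apply: measurable_funM => //.
  apply: (measurableT_comp (continuous_measurable_fun (@continuous_cos R))).
  apply: measurable_funD => //; apply: measurable_sum => i.
  under eq_fun do rewrite mxE.
  by apply: measurable_funM => //; apply: measurable_funM.
have mEK : measurable_fun setT (EFin \o K) by apply/measurable_EFinP.
have := @fubini_tonelli _ _ _ _ R mun mun (EFin \o K) mEK (fun z => K0 z).
have -> : (\int[mun]_x \int[mun]_y (EFin \o K) (x, y) =
    1 + \int[mun]_x (G x * gaussN (2 * pi ^+ 2 * tau ^+ 2) x)%:E)%E.
  rewrite -integral_bessel -ge0_integralD//; first last.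
  - apply/measurable_EFinP/measurable_funM; [exact: measurable_bessel|exact: measurable_gaussN].
  - by move=> x _; rewrite lee_fin mulr_ge0// gaussN_ge0.
  - by apply/measurable_EFinP; exact: measurable_bessel.
  - by move=> x _; rewrite lee_fin.
  apply: eq_integral => x _.
  under eq_integral do rewrite /= /K/= EFinM.
  rewrite ge0_integralZl//=.
  - rewrite integral_normal_pdfN_cos ?normr1// -EFinM -EFinD; congr EFin.
    rewrite cos0 mulrDr mulr1 !mul1r; congr (_ + _ * expR _).
    rewrite (_ : dotrV _ _ = (2 * pi) ^+ 2 * dotrV x x).
      by field.
    rewrite /dotrV mulr_sumr; apply: eq_bigr => i _; rewrite !mxE; ring.
  - by apply/measurable_EFinP; exact: measurable_normal_pdfN_cos.
  - by move=> xi _; rewrite lee_fin normal_pdfN_cos_ge0// normr1.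
  - by rewrite lee_fin.
have -> : (\int[mun]_y \int[mun]_x (EFin \o K) (x, y) =
    1 + \int[mun]_xi (normal_pdfN tau xi * symb xi)%:E)%E.
  rewrite -(@integral_normal_pdfN R n tau)// -ge0_integralD//; first last.
  - apply/measurable_EFinP/measurable_funM; [exact: measurable_normal_pdfN|exact: measurable_symb].
  - by move=> x _; rewrite lee_fin mulr_ge0 ?symb_ge0 ?normal_pdfN_ge0.
  - by apply/measurable_EFinP; exact: measurable_normal_pdfN.
  - by move=> x _; rewrite lee_fin normal_pdfN_ge0.
  apply: eq_integral => xi _.
  have KE x : K (x, xi) = normal_pdfN tau xi * (G x + G x * cos (2 * pi * dotrV x xi)).
    rewrite /K/= (_ : dotrV _ _ = 2 * pi * dotrV x xi).
      by rewrite add0r; ring.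
    by rewrite /dotrV mulr_sumr; apply: eq_bigr => i _; rewrite !mxE mulrA.
  under eq_integral do rewrite /= KE EFinM.
  have iGc : mun.-integrable setT (fun x => (G x * cos (2 * pi * dotrV x xi))%:E).
    apply: integrable_bessel_mul; first exact: measurable_cos_dotrV.
    by move=> x; exact: cos_max.
  rewrite integralZl//=.
  - under eq_integral do rewrite EFinD.
    rewrite integralD// integral_bessel integral_bessel_cos.
    by rewrite -EFinD -EFinM -EFinD mulrDr mulr1.
  - by under eq_fun do rewrite EFinD; exact: integrableD.
by move=> /(congr1 (fun z => z - 1)%E); rewrite !(addeC 1%E) !addeK.
Qed.

(** On the cube of half-side tau = d / pi the symbol is at least
    (1 + 4 n d^2)^(- s / 2), hence at least m d^(- s) when d >= 1, while the
    normal density is at least q / tau per coordinate; the volume (2 tau)^n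
    cancels the powers of tau. *)
Lemma bessel_gauss_lb : 0 < s -> exists2 k : R, 0 < k & forall d, 1 <= d ->
  k * d `^ (- s) <= \int[mun]_x (G x * gaussN (2 * d ^+ 2) x).
Proof.
move=> s0; have pi0 := pi_gt0 R.
pose q := normal_peak 1 * expR (- 2^-1) : R.
have q0 : 0 < q by rewrite mulr_gt0 ?expR_gt0 ?normal_peak_gt0.
pose m := (1 + 4 * n%:R) `^ (- (s / 2)) : R.
have m0 : 0 < m by rewrite powR_gt0// addr_gt0// mulr_ge0.
exists ((2 * q) ^+ n * m); first by apply: mulr_gt0 => //; apply: exprn_gt0; apply: mulr_gt0.
move=> d d1; have d0 : 0 < d by rewrite (lt_le_trans _ d1).
pose tau := d / pi; have tau0 : 0 < tau by rewrite divr_gt0.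
have -> : 2 * d ^+ 2 = 2 * pi ^+ 2 * tau ^+ 2.
  by rewrite /tau; move: (@pi R) (pi_gt0 R) => P P0; field; exact: lt0r_neq0.
rewrite -lee_fin /Rintegral fineK; last first.
  apply: integrable_fin_num => //; apply: integrable_bessel_gauss.
  by apply: mulr_ge0; [apply: mulr_ge0|]; rewrite ?sqr_ge0.
rewrite integral_bessel_gauss//.
pose B := [set x : 'rV[R]_n | forall i, [set` `[- tau, tau]] (x ord0 i)].
have mB : measurable B by exact: measurable_cube.
have mf : measurable_fun setT (fun xi : 'rV[R]_n => (normal_pdfN tau xi * symb xi)%:E).
  by apply/measurable_EFinP/measurable_funM; [exact: measurable_normal_pdfN|exact: measurable_symb].
have f0 (xi : 'rV[R]_n) : (0 <= (normal_pdfN tau xi * symb xi)%:E)%E.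
  by rewrite lee_fin mulr_ge0 ?symb_ge0 ?normal_pdfN_ge0.
apply: (@le_trans _ _ (\int[mun]_(xi in B) (normal_pdfN tau xi * symb xi)%:E)%E); last first.
  exact: ge0_subset_integral.
apply: (@le_trans _ _ (\int[mun]_(xi in B) ((q / tau) ^+ n * (m * d `^ (- s)))%:E)%E).
  rewrite integral_cst//.
  rewrite [X in (_ * X)%E](lebesgueN_cube (ltW tau0)) -EFinM lee_fin.
  rewrite (_ : 2 * q = q / tau * (2 * tau)); last by field; exact: lt0r_neq0.
  by rewrite exprMn le_eqVlt; apply/orP; left; apply/eqP; ring.
apply: ge0_le_integral => //.
- by move=> x _; rewrite lee_fin !mulr_ge0 ?exprn_ge0 ?powR_ge0 ?divr_ge0// ltW.
- by apply: measurable_funTS.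
move=> x Bx; rewrite lee_fin; apply: ler_pM.
- by rewrite exprn_ge0// divr_ge0 ?ltW.
- by rewrite mulr_ge0 ?powR_ge0.
- rewrite -[X in _ ^+ X](card_ord n) -prodr_const; apply: ler_prod => i _.
  rewrite divr_ge0 ?(ltW q0) ?(ltW tau0)//= normal_pdf0E// normal_peakE//.
  rewrite /q [leRHS]mulrAC ler_pM2r ?invr_gt0// ler_pM2l ?normal_peak_gt0//.
  rewrite ler_expR mulNr lerN2 ler_pdivrMr; last by rewrite mulrn_wgt0// exprn_gt0.
  rewrite (_ : 2^-1 * _ = tau ^+ 2); last by rewrite mulr2n; field.
  have := Bx i; rewrite /= in_itv/= => /andP[h1 h2]; nra.
- have dx := dotrV_cube Bx.
  have x0 := dotrV_ge0 x.
  have -> : d `^ (- s) = (d ^+ 2) `^ (- (s / 2)).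
    rewrite -powR_mulrn ?(ltW d0)// -powRrM; congr (_ `^ _).
    by field.
  rewrite -powRM ?sqr_ge0 ?addr_ge0 ?mulr_ge0//.
  rewrite !powRN lef_pV2 ?posrE ?powR_gt0//.
  + apply: ge0_ler_powR; rewrite ?nnegrE ?divr_ge0 ?(ltW s0)//.
    * by rewrite addr_ge0// mulr_ge0// mulr_ge0// sqr_ge0.
    * by rewrite mulr_ge0 ?sqr_ge0// addr_ge0// mulr_ge0.
    * have -> : (1 + 4 * n%:R) * d ^+ 2 = d ^+ 2 + 4 * pi ^+ 2 * (n%:R * tau ^+ 2).
        by rewrite /tau; move: (@pi R) (pi_gt0 R) => P P0; field; exact: lt0r_neq0.
      apply: lerD; first by rewrite expr_ge1// ltW.
      by rewrite ler_pM2l// mulr_gt0// exprn_gt0.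
  + by rewrite mulr_gt0 ?exprn_gt0// ltr_pwDl// mulr_ge0.
  + by rewrite ltr_pwDl// mulr_ge0// mulr_ge0// sqr_ge0.
Qed.

End bessel_gaussian.

(** * The potential and the norms of Gaussians *)

Section gaussian_estimates.
Context {R : realType} {n : nat}.
Local Notation mun := (@lebesgueN R n).
Local Open Scope complex_scope.

Definition gaussC (a : R) (x : 'rV[R]_n) : R[i] := (gaussN a x)%:C.

Lemma normc_real (a : R) : complex.ComplexField.Normc.normc a%:C = `|a|.
Proof. by rewrite /= expr0n/= addr0 sqrtr_sqr. Qed.

Lemma bilinear_potential_gauss (s : R) (G : 'rV[R]_n -> R) (a : R) (x : 'rV[R]_n) :
  is_bessel_kernel s G -> 0 <= a ->
  bilinear_potential G (gaussC a) (gaussC a) x =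
  ((\int[mun]_y (G y * gaussN (2 * a) y)) * gaussN (2 * a) x)%:C.
Proof.
move=> bG a0.
have E y : (G y)%:C * gaussC a (x - y) * gaussC a (x + y) =
    (gaussN (2 * a) x * (G y * gaussN (2 * a) y))%:C.
  by rewrite -!rmorphM/= -mulrA gaussN_parallelogram mulrCA.
rewrite /bilinear_potential /integralC.
under eq_Rintegral => y _ do rewrite E.
rewrite [X in _ +i* X](_ : _ = 0); last first.
  under eq_Rintegral => y _ do rewrite E.
  by rewrite /Rintegral integral0.
rewrite RintegralZl//; last first.
  apply: (integrable_bessel_gauss bG); exact: mulr_ge0.
by rewrite mulrC.
Qed.

(** The rearrangement is tested at t = d^(- n).  On the cube of half-side 1 / d
    the function is at least A exp (- 2 n), and the volume 2^n d^(- n) of this cube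
    exceeds t because n >= 1, so no level below A exp (- 2 n) is admissible in the
    infimum that defines the rearrangement. *)
Lemma weakLnorm_gauss_lb (r A d : R) : (1 <= n)%N -> 0 < r -> 0 <= A -> 0 < d ->
  ((A * expR (- (2 * n%:R)) * d `^ (- (n%:R / r)))%:E <=
   weakLnorm r (fun x : 'rV[R]_n => (A * gaussN (2 * d ^+ 2) x)%:C))%E.
Proof.
move=> n1 r0 A0 d0.
pose t := d `^ (- n%:R).
have t0 : 0 < t by rewrite powR_gt0.
apply: (@le_trans _ _ ((t `^ r^-1)%:E * rearrangement (fun x : 'rV[R]_n => (A * gaussN (2 * d ^+ 2) x)%:C) t)%E); last first.
  by apply: ereal_sup_ubound; exists t.
rewrite (_ : d `^ _ = t `^ r^-1); last by rewrite /t -powRrM mulNr.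
rewrite mulrC EFinM; apply: lee_wpmul2l; first by rewrite lee_fin powR_ge0.
apply: le_ereal_inf_tmp => _ [lambda [l0 dl] <-]; rewrite lee_fin leNgt; apply/negP => lA.
have : ((t < (2 * d^-1) ^+ n)%R)%E.
  rewrite exprMn exprVn /t powRN powR_mulrn ?(ltW d0)//.
  by rewrite ltr_pMl ?invr_gt0 ?exprn_gt0// exprn_egt1 -?lt0n// ltr1n.
have := lebesgueN_cube (n := n) (b := d^-1); rewrite invr_ge0 (ltW d0) => /(_ isT) mC.
rewrite -lte_fin -mC ltNge => /negP; apply; apply: (le_trans _ dl).
have mh : measurable_fun setT (fun x : 'rV[R]_n => A * gaussN (2 * d ^+ 2) x).
  by apply: measurable_funM => //; exact: measurable_gaussN.
have setE : [set x : 'rV[R]_n | lambda < complex.ComplexField.Normc.normc (A * gaussN (2 * d ^+ 2) x)%:C] =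
   [set x : 'rV[R]_n | lambda < A * gaussN (2 * d ^+ 2) x].
  apply/seteqP; split => x /=; rewrite expr0n/= addr0 sqrtr_sqr ger0_norm//;
  by rewrite mulr_ge0 ?gaussN_ge0.
rewrite /distribution_fun setE; apply: le_measure; rewrite ?inE.
- exact: measurable_cube.
- have := mh measurableT _ (measurable_itv `]lambda, +oo[).
  rewrite setTI; congr measurable; apply/seteqP; split => x /=; rewrite in_itv/= andbT//.
move=> x /= Cx; apply: (lt_le_trans lA); rewrite ler_wpM2l// ler_expR lerN2.
have d20 : 0 < 2 * d ^+ 2 by rewrite mulr_gt0 ?exprn_gt0.
have h := dotrV_cube Cx; rewrite -(ler_pM2l d20) in h; apply: (le_trans h).
rewrite le_eqVlt; apply/orP; left; apply/eqP.
by field; exact: lt0r_neq0.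
Qed.

(** For p < oo the p-th power of a Gaussian is a Gaussian, whose integral is
    explicit; for p = oo the exponent of d is 0 since the inverse of p is 0. *)
Lemma Lpnorm_gauss_ub (p : \bar R) : (1 <= p)%E -> exists2 K : R, 0 < K &
  forall d, 0 < d ->
    (Lpnorm p (gaussC (d ^+ 2)) <= (K * d `^ (- (n%:R * fine (p^-1)%E)))%:E)%E.
Proof.
move=> p1; have normE d (x : 'rV[R]_n) :
   `|(complex.ComplexField.Normc.normc (gaussC (d ^+ 2) x))%:E|%E = (gaussN (d ^+ 2) x)%:E.
  by rewrite normc_real /= normr_id ger0_norm ?gaussN_ge0.
case: p p1 => [p||//] p1.
- have p0 : 0 < p by move: p1; rewrite lee_fin; exact: lt_le_trans.
  exists ((Num.sqrt (pi / p) ^+ n) `^ p^-1).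
    by rewrite powR_gt0// exprn_gt0// sqrtr_gt0 divr_gt0// pi_gt0.
  move=> d d0; rewrite /Lpnorm unlock inver (gt_eqF p0) [fine _]/=.
  under eq_integral => x _ do rewrite normE poweR_EFin /gaussN -expRM mulNr mulrAC.
  rewrite (integral_gaussN (b := d ^+ 2 * p)) ?mulr_gt0 ?exprn_gt0// poweR_EFin lee_fin.
  rewrite (_ : pi / (d ^+ 2 * p) = pi / p * d^-1 ^+ 2); last first.
    by move: (@pi R) => P; field; rewrite !lt0r_neq0.
  rewrite sqrtrM ?divr_ge0 ?pi_ge0 ?(ltW p0)// sqrtr_sqr ger0_norm ?invr_ge0 ?(ltW d0)//.
  rewrite exprMn powRM ?exprn_ge0 ?sqrtr_ge0 ?invr_ge0 ?(ltW d0)//.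
  rewrite le_eqVlt; apply/orP; left; apply/eqP; congr (_ * _).
  by rewrite -mulNr powRrM powR_invn ?(ltW d0)// exprVn.
- exists 1 => // d d0; rewrite invey /= mulr0 oppr0 powRr0 mulr1.
  rewrite /Lpnorm unlock; case: ifP => // _.
  by apply/ess_supP; apply: nearW => x; rewrite [(_ \o _) x]normE lee_fin gaussN_le1// sqr_ge0.
Qed.
End gaussian_estimates.

(** * Gaussians are Schwartz functions *)

Section gaussian_schwartz.
Context {R : realType} {n : nat}.
Implicit Types (f P Q : 'rV[R]_n -> R) (x v : 'rV[R]_n).

(** Used to differentiate the composite of the exponential with a function of
    several variables by the one-variable chain rule. *)
Lemma is_derive_lineE f x v (df : R) :
  is_derive x v f df <-> is_derive (0 : R) 1 (fun h : R => f (h *: v + x)) df.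
Proof.
have E : (fun h : R => h^-1 *: ((f \o shift x) (h *: v) - f x)) =
  (fun h : R => h^-1 *: (((fun h : R => f (h *: v + x)) \o shift 0) (h *: 1) -
     (fun h : R => f (h *: v + x)) 0)).
  by apply/funext => h /=; rewrite scale0r add0r addr0 [h *: 1]mulr1.
split=> -[d1 d2]; apply: DeriveDef; move: d1 d2; rewrite /derivable /derive E //.
Qed.

(** Polynomial functions, as the closure of constants and coordinates under sums
    and products: the partial derivatives of a Gaussian are Gaussians times such
    functions, and induction on this predicate replaces formulas for them. *)
Inductive polyfun : ('rV[R]_n -> R) -> Prop :=
| polyfun_cst (c : R) : polyfun (fun=> c)
| polyfun_coord i : polyfun (fun x => x ord0 i)
| polyfunD P Q : polyfun P -> polyfun Q -> polyfun (fun x => P x + Q x)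
| polyfunM P Q : polyfun P -> polyfun Q -> polyfun (fun x => P x * Q x).

Lemma polyfun_sum (I : Type) (r : seq I) (F : I -> 'rV[R]_n -> R) :
  (forall i, polyfun (F i)) -> polyfun (fun x => \sum_(i <- r) F i x).
Proof.
move=> pF; elim: r => [|i r IHr].
  by under eq_fun do rewrite big_nil; exact: polyfun_cst.
by under eq_fun do rewrite big_cons; exact: polyfunD.
Qed.

Lemma polyfun_prod (I : Type) (r : seq I) (F : I -> 'rV[R]_n -> R) :
  (forall i, polyfun (F i)) -> polyfun (fun x => \prod_(i <- r) F i x).
Proof.
move=> pF; elim: r => [|i r IHr].
  by under eq_fun do rewrite big_nil; exact: polyfun_cst.
by under eq_fun do rewrite big_cons; exact: polyfunM.
Qed.

Lemma polyfunX P k : polyfun P -> polyfun (fun x => P x ^+ k).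
Proof.
move=> pP; elim: k => [|k IHk].
  by under eq_fun do rewrite expr0; exact: polyfun_cst.
by under eq_fun do rewrite exprS; exact: polyfunM.
Qed.

Lemma polyfun_dotrV : polyfun (fun x => dotrV x x).
Proof. by apply: polyfun_sum => i; apply: polyfunM; exact: polyfun_coord. Qed.

Lemma continuous_polyfun P : polyfun P -> continuous P.
Proof.
elim=> {P} [c|i|P Q _ cP _ cQ|P Q _ cP _ cQ] x.
- exact: cst_continuous.
- exact: coord_continuous.
- exact: (cvgD (cP x) (cQ x)).
- exact: (cvgM (cP x) (cQ x)).
Qed.

Lemma is_derive_polyfun (i : 'I_n) P : polyfun P ->
  exists2 Q, polyfun Q & forall x, is_derive x (delta_mx ord0 i) P (Q x).
Proof.
elim=> {P} [c|j|P Q pP [P' pP' dP] pQ [Q' pQ' dQ]|P Q pP [P' pP' dP] pQ [Q' pQ' dQ]].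
- by exists (fun=> 0); [exact: polyfun_cst|move=> x; exact: is_derive_cst].
- exists (fun=> (j == i)%:R); first exact: polyfun_cst.
  move=> x; apply/is_derive_lineE.
  under eq_fun do rewrite !mxE eqxx/=.
  apply: is_derive_eq.
  by rewrite /GRing.scale/= !(scaler0, add0r, addr0, mulr1, mulr0).
- exists (fun x => P' x + Q' x); first exact: polyfunD.
  by move=> x; exact: is_deriveD.
- exists (fun x => P x * Q' x + Q x * P' x).
    by apply: polyfunD; exact: polyfunM.
  by move=> x; exact: is_deriveM.
Qed.

(** The rate e is arbitrary so that a product can be handled by giving half of it
    to each factor. *)
Lemma polyfun_expR_bound P (e : R) : polyfun P -> 0 < e ->
  exists2 M, 0 <= M & forall x, `|P x| <= M * expR (e * dotrV x x).
Proof.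
move=> pP; elim: pP e => {P} [c|i|P Q _ IHP _ IHQ|P Q _ IHP _ IHQ] e e0.
- exists `|c| => // x; rewrite ler_peMr// -expR0 ler_expR.
  by rewrite mulr_ge0 ?dotrV_ge0 ?ltW.
- exists (1 + e^-1); first by rewrite addr_ge0 ?invr_ge0 ?ltW.
  move=> x; apply: (le_trans (ler_abs_expR_sqr _ e0)).
  rewrite ler_pM2l ?addr_gt0 ?invr_gt0// ler_expR ler_pM2l// /dotrV (bigD1 i)//=.
  by rewrite expr2 lerDl sumr_ge0// => j _; rewrite -expr2 sqr_ge0.
- have [M M0 HM] := IHP _ e0; have [N N0 HN] := IHQ _ e0.
  exists (M + N); first exact: addr_ge0.
  by move=> x; rewrite mulrDl (le_trans (ler_normD _ _))// lerD.
- have e20 : 0 < e / 2 by rewrite divr_gt0.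
  have [M M0 HM] := IHP _ e20; have [N N0 HN] := IHQ _ e20.
  exists (M * N); first exact: mulr_ge0.
  move=> x; rewrite normrM [e](splitr e) mulrDl expRD mulrACA.
  by apply: ler_pM.
Qed.

Lemma is_derive_expR_polyfun P v x (dP : R) : is_derive x v P dP ->
  is_derive x v (expR \o P) (dP * expR (P x)).
Proof.
move=> /is_derive_lineE dPx; apply/is_derive_lineE.
have := @is_derive1_comp R expR (fun h : R => P (h *: v + x)) 0 _ dP.
rewrite scale0r add0r => /(_ (expR (P x)) (is_derive_expR _) dPx) h.
apply: (is_derive_eq h).
by rewrite mulrC.
Qed.

Lemma gaussNE a : gaussN a = expR \o (fun x => - a * dotrV x x).
Proof. by apply/funext => x; rewrite /gaussN/= mulNr. Qed.

Lemma continuous_gaussN a : continuous (@gaussN R n a).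
Proof.
move=> x; rewrite gaussNE; apply: continuous_comp; last exact: continuous_expR.
apply: continuous_polyfun.
by apply: polyfunM; [exact: polyfun_cst|exact: polyfun_dotrV].
Qed.

Lemma is_derive_polyfun_gaussN a (i : 'I_n) P : polyfun P ->
  exists2 Q, polyfun Q & forall x,
    is_derive x (delta_mx ord0 i) (fun x => P x * gaussN a x) (Q x * gaussN a x).
Proof.
move=> pP; have [P' pP' dP] := is_derive_polyfun i pP.
have pD : polyfun (fun x => - a * dotrV x x).
  by apply: polyfunM; [exact: polyfun_cst|exact: polyfun_dotrV].
have [D' pD' dD] := is_derive_polyfun i pD.
exists (fun x => P x * D' x + P' x).
  by apply: polyfunD => //; exact: polyfunM.
move=> x; have dg : is_derive x (delta_mx ord0 i) (gaussN a) (D' x * gaussN a x).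
  by rewrite gaussNE; exact: is_derive_expR_polyfun.
by apply: (is_derive_eq (is_deriveM (dP x) dg)); rewrite /GRing.scale/=; ring.
Qed.

Lemma partials_polyfun_gaussN a (l : seq 'I_n) P : polyfun P ->
  exists2 Q, polyfun Q & partials l (fun x => P x * gaussN a x) = (fun x => Q x * gaussN a x).
Proof.
move=> pP; elim: l => [|i l [Q pQ IHl]] /=; first by exists P.
have [Q' pQ' dQ] := is_derive_polyfun_gaussN a i pQ.
exists Q' => //; apply/funext => x.
by rewrite IHl; have [_ ->] := dQ x.
Qed.

(** The polynomial factor is kept general to cover with P = 1 and P = 0 the real
    and the imaginary part of a real Gaussian. *)
Lemma schwartzR_polyfun_gaussN a P : 0 < a -> polyfun P ->
  schwartzR (fun x => P x * gaussN a x).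
Proof.
move=> a0 pP; split.
  move=> l; have [Q pQ ->] := partials_polyfun_gaussN a l pP; split.
    have cQ : continuous Q by exact: continuous_polyfun.
    have cg : continuous (@gaussN R n a) by exact: continuous_gaussN.
    by move=> x; exact: (cvgM (cQ x) (cg x)).
  move=> i x; have [Q' pQ' dQ] := is_derive_polyfun_gaussN a i pQ.
  by have [] := dQ x.
move=> e l; have [Q pQ ->] := partials_polyfun_gaussN a l pP.
have pm : polyfun (fun x => (\prod_(i < n) x ord0 i ^+ e i) * Q x).
  by apply: polyfunM => //; apply: polyfun_prod => i; apply: polyfunX; exact: polyfun_coord.
have [M M0 HM] := polyfun_expR_bound pm a0.
exists M => x; rewrite mulrA normrM (ger0_norm (gaussN_ge0 _ _)).
by rewrite /gaussN expRN ler_pdivrMr ?expR_gt0.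
Qed.

Lemma schwartz_gaussC (a : R) : 0 < a -> schwartz (@gaussC R n a).
Proof.
move=> a0; split.
  rewrite (_ : (fun x => _) = fun x => (fun=> 1) x * gaussN a x).
    by apply: schwartzR_polyfun_gaussN => //; exact: polyfun_cst.
  by apply/funext => x; rewrite mul1r.
rewrite (_ : (fun x => _) = fun x => (fun=> 0) x * gaussN a x).
  by apply: schwartzR_polyfun_gaussN => //; exact: polyfun_cst.
by apply/funext => x; rewrite mul0r.
Qed.

End gaussian_schwartz.

(** * Comparison of exponents *)

Lemma gt0_powRD {R : realType} (d u v : R) : 0 < d ->
  d `^ (u + v) = d `^ u * d `^ v.
Proof. by move=> d0; rewrite powRD// lt0r_neq0 ?implybT. Qed.

Lemma powR_exponent_le {R : realType} (k M u v : R) : 0 < k ->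
  (forall d, 1 <= d -> k * d `^ u <= M * d `^ v) -> u <= v.
Proof.
move=> k0 H; rewrite leNgt; apply/negP => vu.
have uv : 0 < u - v by rewrite subr_gt0.
have M0 : 0 < M.
  by have := H 1 (lexx _); rewrite !powR1 !mulr1; exact: lt_le_trans.
(* at this d the left-hand side is (M + k) d^v, which exceeds M d^v *)
pose d := (M / k + 1) `^ (u - v)^-1.
have Mk : 0 < M / k by rewrite divr_gt0.
have d1 : 1 <= d.
  have -> : 1 = 1 `^ (u - v)^-1 by rewrite powR1.
  by apply: ge0_ler_powR; rewrite ?nnegrE ?invr_ge0 ?(ltW uv) ?addr_ge0 ?(ltW Mk)// lerDr ltW.
have d0 : 0 < d by rewrite (lt_le_trans _ d1).
have dv0 : 0 < d `^ v by exact: powR_gt0.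
have := H d d1.
rewrite (_ : d `^ u = d `^ (u - v) * d `^ v); last first.
  by rewrite -gt0_powRD// subrK.
rewrite mulrA ler_pM2r//.
rewrite /d -powRrM mulVf ?lt0r_neq0// powRr1 ?addr_ge0 ?(ltW Mk)//.
rewrite mulrDr mulr1 mulrC divfK ?lt0r_neq0//.
by rewrite gerDl leNgt k0.
Qed.

Theorem proposition3p1 (R : realType) (n : nat) (s : R) (p q : \bar R) (r : R)
  (G : 'rV[R]_n -> R) :
  (1 <= n)%N -> 0 < s < n%:R ->
  (1 <= p)%E -> (1 <= q)%E -> 0 < r ->
  is_bessel_kernel s G ->
  (exists C : R, 0 < C /\
     forall f g : 'rV[R]_n -> R[i], schwartz f -> schwartz g ->
       (weakLnorm r (bilinear_potential G f g)
          <= C%:E * Lpnorm p f * Lpnorm q g)%E) ->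
  (p^-1 + q^-1 - (s / n%:R)%:E <= (r^-1)%:E <= p^-1 + q^-1)%E.
Proof.
move=> n1 /andP[s0 _] p1 q1 r0 bG [C [C0 HC]].
have n0 : 0 < n%:R :> R by rewrite ltr0n.
have invfin (z : \bar R) : (1 <= z)%E -> (z^-1 = (fine z^-1)%:E)%E.
  case: z => [z||//] z1; last by rewrite invey.
  by rewrite inver gt_eqF// (lt_le_trans ltr01).
have [Kp Kp0 HKp] := Lpnorm_gauss_ub (n := n) p1.
have [Kq Kq0 HKq] := Lpnorm_gauss_ub (n := n) q1.
rewrite (invfin p p1) (invfin q q1).
set ip := fine (p^-1)%E in HKp *; set iq := fine (q^-1)%E in HKq *.
have [k k0 Hk] := bessel_gauss_lb bG s0.
pose c d := \int[lebesgueN n]_y (G y * gaussN (2 * d ^+ 2) y).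
have main d : 0 < d ->
    c d * expR (- (2 * n%:R)) * d `^ (- (n%:R / r)) <=
    (C * Kp * Kq) * d `^ (- (n%:R * (ip + iq))).
  move=> d0; have d20 : 0 < d ^+ 2 by rewrite exprn_gt0.
  have c0 : 0 <= c d.
    apply: Rintegral_ge0 => x _; have [G0 _ _] := bG.
    by rewrite mulr_ge0// gaussN_ge0.
  have := HC _ _ (schwartz_gaussC d20) (schwartz_gaussC d20).
  rewrite (_ : bilinear_potential _ _ _ = fun x => (c d * gaussN (2 * d ^+ 2) x)%:C%C); last first.
    by apply/funext => x; rewrite (bilinear_potential_gauss _ bG (ltW d20)).
  move=> /(le_trans (weakLnorm_gauss_lb n1 r0 c0 d0)).
  have Lge0 z f : (0 <= Lpnorm (n := n) z f)%E by exact: Lnorm_ge0.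
  move=> h; rewrite -lee_fin; apply: (le_trans h).
  rewrite -muleA (_ : C * Kp * Kq * _ = C * ((Kp * d `^ (- (n%:R * ip))) * (Kq * d `^ (- (n%:R * iq))))).
    rewrite EFinM lee_pmul2l// EFinM.
    by apply: lee_pmul; [exact: Lge0|exact: Lge0|exact: HKp|exact: HKq].
  rewrite mulrDr opprD gt0_powRD//.
  ring.
pose k' := k * expR (- (2 * n%:R)).
have k'0 : 0 < k' by rewrite mulr_gt0 ?expR_gt0.
rewrite -!EFinD !lee_fin; apply/andP; split.
(* the regime d -> oo *)
- have /powR_exponent_le : forall d, 1 <= d ->
      k' * d `^ (- s - n%:R / r) <= (C * Kp * Kq) * d `^ (- (n%:R * (ip + iq))).
    move=> d d1; have d0 : 0 < d by rewrite (lt_le_trans _ d1).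
    apply: (le_trans _ (main d d0)).
    rewrite gt0_powRD//.
    rewrite mulrA ler_wpM2r ?powR_ge0// /k' mulrAC ler_wpM2r ?expR_ge0//.
    exact: Hk.
  move=> /(_ k'0) h; rewrite -(ler_pM2l n0) mulrBr mulrCA divff ?gt_eqF// mulr1.
  lra.
(* the regime d -> 0, in the variable 1 / d *)
- have /powR_exponent_le : forall d, 1 <= d ->
      k' * d `^ (n%:R / r) <= (C * Kp * Kq) * d `^ (n%:R * (ip + iq)).
    move=> d d1; have d0 : 0 < d by rewrite (lt_le_trans _ d1).
    have dV0 : 0 < d^-1 by rewrite invr_gt0.
    have dV1 : d^-1 <= 1 by rewrite invf_le1.
    have dVE z : d^-1 `^ (- z) = d `^ z.
      by rewrite -powR_inv1 ?(ltW d0)// -powRrM mulrN mulN1r opprK.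
    have := main _ dV0; rewrite !dVE; apply: le_trans.
    rewrite ler_wpM2r ?powR_ge0// /k' ler_wpM2r ?expR_ge0//.
    (* c is nonincreasing and c(1) >= k *)
    have := Hk 1 (lexx _); rewrite powR1 mulr1 => /le_trans; apply.
    have [G0 _ _] := bG.
    apply: le_Rintegral => //.
    + by apply: (integrable_bessel_gauss bG); rewrite mulr_ge0 ?sqr_ge0.
    + by apply: (integrable_bessel_gauss bG); rewrite mulr_ge0 ?sqr_ge0.
    move=> x _; rewrite ler_wpM2l// ler_expR lerN2 ler_wpM2r ?dotrV_ge0//.
    by rewrite ler_pM2l// expr1n expr_le1// ltW.
  by move=> /(_ k'0); rewrite ler_pM2l.
Qed.
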